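(* Let $d\ge 2$ be an integer and let $\mu^0_{n,d}$ be the uniform probability measure on the set $\mathcal{L}^0_{n,d}$ of $1$-Lipschitz functions $f\colon V(\mathbb{T}^n_d)\to\mathbb{Z}$ that take the value $0$ at every vertex at distance exactly $n$ from the root. Then $\mu^0_{n,d}$ converges (in the local weak sense) as $n\to\infty$ if and only if $2\le d\le 7$.
   Context: A $d$-ary tree $\mathbb{T}_d$ is an infinite tree with a distinguished root vertex $\rho$ of degree $d$, all other vertices having degree $d+1$. $\mathbb{T}^n_d$ is the finite subtree induced by the vertices at graph distance at most $n$ from $\rho$; its leaves are the vertices at distance exactly $n$. A function $f$ on the vertices of a graph is $1$-Lipschitz (integer-valued) if $f$ takes values in $\mathbb{Z}$ and $|f(u)-f(v)|\le 1$ for all adjacent $u,v$. Local weak convergence of $\mu^0_{n,d}$ means: for every fixed $r\ge 0$, the law under $\mu^0_{n,d}$ of the restriction of $f$ to the vertices within distance $r$ of $\rho$ converges, as $n\to\infty$, to a probability measure. *)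

(* Defs.v *)
From HB Require Import structures.
From mathcomp Require Import all_boot all_order all_algebra.
From mathcomp Require Import all_classical all_reals all_analysis.
From mathcomp Require Import finmap Rstruct Rstruct_topology.

Set Implicit Arguments.
Unset Strict Implicit.
Unset Printing Implicit Defensive.

Import Order.TTheory GRing.Theory Num.Theory.
Local Open Scope classical_set_scope.
Local Open Scope ring_scope.
Local Open Scope fset_scope.

(* Vertices of the finite d-ary tree T^n_d: words over the alphabet 'I_d of
   length k <= n (the root is the empty word; a vertex of depth k is a word of
   length k; its children are obtained by appending one letter). *)
Definition vert (n d : nat) : finType := {k : 'I_n.+1 & k.-tuple 'I_d}.

Definition vseq {n d : nat} (v : vert n d) : seq 'I_d := val (tagged v).

Definition depth {n d : nat} (v : vert n d) : nat := size (vseq v).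

Definition tree_edge {n d : nat} (u v : vert n d) : Prop :=
  exists i : 'I_d, vseq v = rcons (vseq u) i.

Definition lipschitz1 {n d : nat} (f : {ffun vert n d -> int}) : Prop :=
  forall u v : vert n d, tree_edge u v -> `|f u - f v| <= 1.

Definition L0 (n d : nat) : set {ffun vert n d -> int} :=
  [set f | lipschitz1 f /\ forall v : vert n d, depth v = n -> f v = 0].

(* event that the restriction of f to the ball of radius r around the root
   equals the configuration h (indexed by the vertices of T^r_d) *)
Definition cyl (n d r : nat) (h : {ffun vert r d -> int}) : set {ffun vert n d -> int} :=
  [set f | @L0 n d f /\
     forall (v : vert n d) (w : vert r d), vseq v = vseq w -> f v = h w].

Definition mu0_ball (n d r : nat) (h : {ffun vert r d -> int}) : Rdefinitions.R :=
  (#|` fset_set (@cyl n d r h)|%:R / #|` fset_set (@L0 n d)|%:R).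

(* Local weak convergence: for every r, the law of the restriction of f to the
   ball of radius r (a law on the countable set of integer configurations on
   that ball) converges as n -> oo to a probability measure q. *)
Definition local_weak_conv (d : nat) : Prop :=
  forall r : nat, exists q : {ffun vert r d -> int} -> Rdefinitions.R,
    (forall h, 0 <= q h) /\
    (\esum_(h in [set: {ffun vert r d -> int}]) (q h)%:E = 1%E) /\
    (forall h, (fun n : nat => @mu0_ball n d r h) @ \oo --> q h).

(* Main.v *)
(* Let a_n(k) be the number of admissible functions on T^n_d with value k at the
   root.  Then a_{n+1}(k) = (a_n(k-1) + a_n(k) + a_n(k+1))^d, and the normalised
   d-th roots z_n(k) = (a_n(k) / a_n(0))^(1/d) satisfy, with X_k = z_n(k)^d,
   z_{n+1}(k) = (X_{k-1} + X_k + X_{k+1}) / (1 + 2 X_1) for k >= 1.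
   The dynamics is governed by k = 1: neglecting X_2 it reads
   z |-> (1 + z^d) / (1 + 2 z^d), whose derivative is bounded in absolute value by
   max_z d z^(d-1) / (1 + 2 z^d)^2, which is about 0.986 for d = 7 and 1.108 for
   d = 8.  For d <= 7 the full map is a contraction for the sup norm on an invariant
   region, so z_n converges geometrically; this gives convergence of the
   cylinder probabilities, and no mass escapes since n c^n -> 0.
   For d >= 8 the values of X_1 stay below some b < 2/5 at even times and above 2/5
   at odd times, which contradicts convergence of the law at the root. *)
Require Import Defs.
From mathcomp Require Import all_boot all_order all_algebra.
From mathcomp Require Import all_classical all_reals all_analysis.
From mathcomp Require Import finmap Rstruct Rstruct_topology ring lra zify.

Set Implicit Arguments.
Unset Strict Implicit.
Unset Printing Implicit Defensive.

Import Order.TTheory GRing.Theory Num.Theory.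
Import numFieldNormedType.Exports.
Local Open Scope ring_scope.
Local Open Scope classical_set_scope.

(** * Powers and sequences with geometric increments *)

(** The tangent of x^(m+1) at z lies below the graph at w. It bounds a multiple of z^m by an affine
    function of z^(m+1). *)
Lemma pow_tangent (R : realDomainType) (m : nat) (z w : R) : 0 <= z -> 0 <= w ->
  m.+1%:R * w * z ^+ m <= m%:R * z ^+ m.+1 + w ^+ m.+1.
Proof.
move=> z0 w0; elim: m => [|m IH]; first by rewrite mul0r add0r expr0 expr1 mulr1 mul1r.
have zm : 0 <= z ^+ m by rewrite exprn_ge0.
have := ler_wpM2l w0 IH.
have : 0 <= m.+1%:R * z ^+ m * (z - w) ^+ 2 by rewrite mulr_ge0 ?sqr_ge0 // mulr_ge0.
move: zm; rewrite !exprS; set Z := z ^+ m; set W := w ^+ m.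
rewrite -![m.+2%:R]natr1 -![m.+1%:R]natr1; set M := m%:R.
by move=> *; lra.
Qed.

Lemma pow_quotient_derive (R : realType) (d : nat) (x : R) : 0 <= x ->
  is_derive x 1 (fun y : R => (1 + 2 * y ^+ d)^-1)
    (- (1 + 2 * x ^+ d) ^- 2 * (2 * (d%:R * x ^+ d.-1))).
Proof.
move=> x0; have xd : 0 <= x ^+ d by rewrite exprn_ge0.
have N0 : 1 + 2 * x ^+ d != 0 by apply/eqP; lra.
apply: is_deriveV => //.
have -> : (fun y : R => 1 + 2 * y ^+ d) = cst 1 + (2 : R) *: (id ^+ d : R -> R).
  by apply/funext => y; rewrite /GRing.add /GRing.scale /=; congr (_ + _ * _); rewrite fctE.
have := is_deriveD (is_derive_cst (1 : R) x 1)
  (is_deriveZ (2 : R) (is_deriveX d (is_derive_id x (1 : R)))).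
by rewrite /GRing.scale /= add0r mulr1.
Qed.

(** Up to sign the quotient is half the increment of 1 / (1 + 2 x^d), so the mean value theorem
    applies; the hypothesis bounds d x^(d-1) / (1 + 2 x^d)^2. *)
Lemma pow_quotient_lip (R : realType) (d : nat) (q : R) :
  (forall x : R, 0 <= x -> d%:R * x ^+ d.-1 <= q * (1 + 2 * x ^+ d) ^+ 2) ->
  forall z w, 0 <= z -> 0 <= w ->
  `|(w ^+ d - z ^+ d) / ((1 + 2 * z ^+ d) * (1 + 2 * w ^+ d))| <= q * `|z - w|.
Proof.
move=> dq z w; wlog zw : z w / z <= w => [H z0 w0|z0 w0].
  have [zw|wz] := leP z w; first exact: H.
  by rewrite -normrN -mulNr opprB [X in _ / X]mulrC distrC; apply: H => //; exact: ltW.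
have N0 (x : R) : 0 <= x -> 1 + 2 * x ^+ d != 0.
  by move=> x0; have := exprn_ge0 d x0 => ?; apply/eqP; lra.
have [x|x xzw|x] := @MVT_segment R (fun y : R => (1 + 2 * y ^+ d)^-1)
  (fun x => - (1 + 2 * x ^+ d) ^- 2 * (2 * (d%:R * x ^+ d.-1))) z w zw.
- rewrite in_itv /= => /andP[zx _]; apply: pow_quotient_derive.
  exact: ltW (le_lt_trans z0 zx).
- apply: continuous_in_subspaceT => y /set_mem /=; rewrite in_itv /= => /andP[zy _].
  apply: differentiable_continuous; apply/derivable1_diffP.
  by have [] := @pow_quotient_derive R d y (le_trans z0 zy).
rewrite in_itv /= => /andP[zx _] E; have x0 := le_trans z0 zx.
have -> : (w ^+ d - z ^+ d) / ((1 + 2 * z ^+ d) * (1 + 2 * w ^+ d)) =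
    (d%:R * x ^+ d.-1) / (1 + 2 * x ^+ d) ^+ 2 * (w - z).
  transitivity (- ((1 + 2 * w ^+ d)^-1 - (1 + 2 * z ^+ d)^-1) / 2).
    by field; rewrite !N0.
  by rewrite E; field; rewrite !N0.
rewrite normrM [X in _ <= _ * X]distrC ger0_norm; last first.
  by rewrite divr_ge0 ?exprn_even_ge0 // mulr_ge0 // exprn_ge0.
rewrite ler_wpM2r // ler_pdivrMr ?dq //.
by rewrite exprn_even_gt0 //= N0.
Qed.

Lemma pow_lip (R : realDomainType) (m : nat) (s a b : R) :
  0 <= a <= s -> 0 <= b <= s ->
  `|a ^+ m.+1 - b ^+ m.+1| <= m.+1%:R * s ^+ m * `|a - b|.
Proof.
move=> /andP[a0 asl] /andP[b0 bs].
have s0 := le_trans a0 asl.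
elim: m => [|m IH]; first by rewrite !expr1 expr0 mulr1 mul1r.
have -> : a ^+ m.+2 - b ^+ m.+2 = a * (a ^+ m.+1 - b ^+ m.+1) + (a - b) * b ^+ m.+1.
  by rewrite !(exprS _ m.+1); ring.
apply: le_trans (ler_normD _ _) _; rewrite !normrM (ger0_norm a0).
rewrite (ger0_norm (exprn_ge0 _ b0)).
have h1 : a * `|a ^+ m.+1 - b ^+ m.+1| <= s * (m.+1%:R * s ^+ m * `|a - b|).
  by rewrite ler_pM.
have h2 : `|a - b| * b ^+ m.+1 <= `|a - b| * s ^+ m.+1.
  by rewrite ler_wpM2l // lerXn2r ?nnegrE.
apply: le_trans (lerD h1 h2) _.
by rewrite -[m.+2%:R]natr1 exprS; lra.
Qed.

(** With D = C / (1 - c) the intervals [u n - D c^n, u n + D c^n] are nested; the limit is the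
    supremum of their left ends. *)
Lemma geometric_increments (R : realType) (u : nat -> R) (C c : R) :
  0 <= C -> 0 <= c < 1 -> (forall n, `|u n.+1 - u n| <= C * c ^+ n) ->
  exists l, forall n, `|u n - l| <= C / (1 - c) * c ^+ n.
Proof.
move=> C0 /andP[c0 c1] uC; set D := C / (1 - c).
have DC : D * (1 - c) = C by rewrite divfK // gt_eqF // subr_gt0.
have D0 : 0 <= D by rewrite divr_ge0 // subr_ge0 ltW.
have cn n : 0 <= c ^+ n by rewrite exprn_ge0.
pose lo n := u n - D * c ^+ n; pose hi n := u n + D * c ^+ n.
have step n : lo n <= lo n.+1 /\ hi n.+1 <= hi n.
  have := uC n; rewrite ler_norml /lo /hi exprS => /andP[].
  rewrite -{1 2}DC; set p := c ^+ n => ? ?; split; lra.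
have lo_le m k : lo m <= lo (m + k)%N.
  elim: k => [|k IH]; rewrite ?addn0 // addnS; exact: le_trans IH (step _).1.
have hi_le m k : hi (m + k)%N <= hi m.
  elim: k => [|k IH]; rewrite ?addn0 // addnS; exact: le_trans (step _).2 IH.
have lohi m n : lo m <= hi n.
  apply: (le_trans (lo_le m n)); apply: le_trans (hi_le n m); rewrite addnC /lo /hi.
  by have := mulr_ge0 D0 (cn (n + m)%N); lra.
have ub : has_ubound (range lo) by exists (hi 0%N) => _ [m _ <-].
exists (sup (range lo)) => n.
have h1 : lo n <= sup (range lo) by apply: ub_le_sup => //; exists n.
have h2 : sup (range lo) <= hi n.
  by apply: ge_sup; [exists (lo 0%N), 0%N | move=> _ [m _ <-]].
by rewrite ler_norml; move: h1 h2; rewrite /lo /hi; lra.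
Qed.

(** * The recursion for the normalised root weights *)

(* [root_ratio R d n k] is (a_n(k) / a_n(0))^(1/d), see [root_count_ratio]; the case
   k = 1 of the step uses z 0 = 1. *)
Definition ratio_step (R : fieldType) (d : nat) (z : nat -> R) (k : nat) : R :=
  if k is j.+1 then
    (z j ^+ d + z j.+1 ^+ d + z j.+2 ^+ d) / (1 + 2 * z 1%N ^+ d)
  else 1.

Fixpoint root_ratio (R : fieldType) (d n : nat) : nat -> R :=
  if n is m.+1 then ratio_step d (root_ratio R d m) else fun k => (k == 0%N)%:R.

(** * Contraction of the step in the sup norm *)

Lemma quot_bound (R : realFieldType) (b N q D M : R) :
  1 <= N -> `|q| <= D * M -> D <= b * N -> 0 <= M -> `|q / N| <= b * M.
Proof.
move=> N1 qD DN M0; have N0 : 0 < N by lra.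
rewrite normrM normfV (gtr0_norm N0) ler_pdivrMr //.
by apply: (le_trans qD); have := ler_wpM2r M0 DN; lra.
Qed.

(** A change of z acts on the denominator, measured by [q], and on the numerator coordinates 2 and
    >= 3, measured by [b1] and [b2]. The three hypotheses with right-hand side [c] add these effects
    up for the coordinates 1, 2 and >= 3. *)
Lemma ratio_step_contract (R : realType) (m : nat) (s t L q b1 b2 c M : R)
    (z y : nat -> R) :
  let d := m.+1 in
  let S := s ^+ d in let T := t ^+ d in
  (forall x : R, 0 <= x -> d%:R * x ^+ m <= q * (1 + 2 * x ^+ d) ^+ 2) ->
  d%:R * s ^+ m <= b1 * (1 + 2 * L ^+ d) ->
  d%:R * t ^+ m <= b2 * (1 + 2 * L ^+ d) ->
  0 <= L -> 0 <= b2 <= b1 -> 0 <= q ->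
  q * (1 + 2 * S) + b1 <= c -> q + b1 + b2 <= c ->
  2 * (S + 2 * T) * q + b1 + 2 * b2 <= c -> 0 <= t <= s -> S + T <= 1 ->
  z 0%N = 1 -> y 0%N = 1 -> L <= z 1%N -> L <= y 1%N ->
  0 <= z 2%N <= s -> 0 <= y 2%N <= s ->
  (forall k, 0 <= z k.+3 <= t) -> (forall k, 0 <= y k.+3 <= t) ->
  (forall k, `|z k - y k| <= M) ->
  forall k, `|ratio_step d z k - ratio_step d y k| <= c * M.
Proof.
move=> d S T dq b1L b2L L0 /andP[b20 b21] q0 c1 c2 c3 /andP[t0 ts] ST z0 y0 Lz Ly.
move=> z2 y2 z3 y3 M_ub.
have b10 := le_trans b20 b21.
have M0 : 0 <= M by apply: le_trans (M_ub 0%N).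
have S0 : 0 <= S by rewrite exprn_ge0 //; exact: le_trans t0 ts.
have T0 : 0 <= T by rewrite exprn_ge0.
have TS : T <= S by rewrite lerXn2r // nnegrE //; exact: le_trans t0 ts.
have z1_ge0 := le_trans L0 Lz; have y1_ge0 := le_trans L0 Ly.
have powle (a u : R) : 0 <= a <= u -> 0 <= a ^+ d <= u ^+ d.
  by move=> /andP[a0 au]; rewrite exprn_ge0 // lerXn2r // nnegrE //; exact: le_trans a0 au.
pose N := 1 + 2 * z 1%N ^+ d; pose N' := 1 + 2 * y 1%N ^+ d.
have LN : 1 + 2 * L ^+ d <= N.
  rewrite lerD2l ler_pM2l //.
  by have /andP[_] := powle L (z 1%N) (introT andP (conj L0 Lz)).
have N1 : 1 <= N by have := exprn_ge0 d z1_ge0; rewrite /N; lra.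
have N'1 : 1 <= N' by have := exprn_ge0 d y1_ge0; rewrite /N'; lra.
have N0 : N != 0 by apply/eqP; lra.
have N'0 : N' != 0 by apply/eqP; lra.
(* All changes of the denominator are expressed through [P], the increment of
   x^d / (1 + 2 x^d), which the derivative bound [q] controls. *)
pose P := (y 1%N ^+ d - z 1%N ^+ d) / (N * N').
have PM : `|P| <= q * M.
  apply: le_trans (pow_quotient_lip dq z1_ge0 y1_ge0) _.
  by rewrite ler_wpM2l.
have Q2 : `|(z 2%N ^+ d - y 2%N ^+ d) / N| <= b1 * M.
  apply: (@quot_bound _ _ _ _ (d%:R * s ^+ m)) => //.
    apply: (le_trans (pow_lip m z2 y2)); rewrite ler_wpM2l //.
    by rewrite mulr_ge0 // exprn_ge0 //; exact: le_trans t0 ts.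
  by apply: (le_trans b1L); rewrite ler_wpM2l.
have Q3 k : `|(z k.+3 ^+ d - y k.+3 ^+ d) / N| <= b2 * M.
  apply: (@quot_bound _ _ _ _ (d%:R * t ^+ m)) => //.
    apply: (le_trans (pow_lip m (z3 k) (y3 k))); rewrite ler_wpM2l //.
    by rewrite mulr_ge0 // exprn_ge0.
  by apply: (le_trans b2L); rewrite ler_wpM2l.
have Y2 := powle _ _ y2; have Y3 k := powle _ _ (y3 k).
rewrite -/S in Y2; rewrite -/T in Y3.
have qM0 : 0 <= q * M by rewrite mulr_ge0.
have b1M0 : 0 <= b1 * M by rewrite mulr_ge0.
have b2M0 : 0 <= b2 * M by rewrite mulr_ge0.
have c1M := ler_wpM2r M0 c1; have c2M := ler_wpM2r M0 c2; have c3M := ler_wpM2r M0 c3.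
have SqM := mulr_ge0 S0 qM0; have TqM := mulr_ge0 T0 qM0.
have PS a B : `|a| <= B -> `|P * a| <= q * M * B.
  by move=> aB; rewrite normrM ler_pM.
have b21M := ler_wpM2r M0 b21.
move=> [|[|[|k]]] /=.
- by rewrite subrr normr0; apply: le_trans c2M; nra.
- rewrite z0 y0 expr1n -/N -/N'.
  (* From y to z, (1 + x) / (1 + 2 x) changes by P and 1 / (1 + 2 x) by 2 P. *)
  have -> : (1 + z 1%N ^+ d + z 2%N ^+ d) / N - (1 + y 1%N ^+ d + y 2%N ^+ d) / N' =
     P * (1 + 2 * y 2%N ^+ d) + (z 2%N ^+ d - y 2%N ^+ d) / N.
    by rewrite /P; move: N0 N'0; rewrite /N /N' => ? ?; field; apply/andP.
  apply: le_trans (ler_normD _ _) _.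
  have /PS : `|1 + 2 * y 2%N ^+ d| <= 1 + 2 * S by rewrite ger0_norm; lra.
  by lra.
- rewrite -/N -/N'.
  (* Here x / (1 + 2 x) changes by -P, against the positive terms of the tail; the factor of P stays
     in [-1, 1] because S + T <= 1. *)
  have -> : (z 1%N ^+ d + z 2%N ^+ d + z 3%N ^+ d) / N
            - (y 1%N ^+ d + y 2%N ^+ d + y 3%N ^+ d) / N' =
     P * (2 * (y 2%N ^+ d + y 3%N ^+ d) - 1) + (z 2%N ^+ d - y 2%N ^+ d) / N
     + (z 3%N ^+ d - y 3%N ^+ d) / N.
    by rewrite /P; move: N0 N'0; rewrite /N /N' => ? ?; field; apply/andP.
  apply: le_trans (ler_normD _ _) _; apply: le_trans (lerD (ler_normD _ _) (lexx _)) _.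
  have /PS : `|2 * (y 2%N ^+ d + y 3%N ^+ d) - 1| <= 1.
    by have := Y3 0%N; rewrite ler_norml; lra.
  by have := Q3 0%N; lra.
- rewrite -/N -/N'.
  have -> : (z k.+2 ^+ d + z k.+3 ^+ d + z k.+4 ^+ d) / N
            - (y k.+2 ^+ d + y k.+3 ^+ d + y k.+4 ^+ d) / N' =
     P * (2 * (y k.+2 ^+ d + y k.+3 ^+ d + y k.+4 ^+ d)) + (z k.+2 ^+ d - y k.+2 ^+ d) / N
     + (z k.+3 ^+ d - y k.+3 ^+ d) / N + (z k.+4 ^+ d - y k.+4 ^+ d) / N.
    by rewrite /P; move: N0 N'0; rewrite /N /N' => ? ?; field; apply/andP.
  (* The index [k.+2] may be 2, so this coordinate gets the weaker bounds S and [b1]. *)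
  have Yk : 0 <= y k.+2 ^+ d <= S.
    by case: k => [//|k]; have := Y3 k; lra.
  have Qk : `|(z k.+2 ^+ d - y k.+2 ^+ d) / N| <= b1 * M.
    by case: k {Yk} => [//|k]; exact: le_trans (Q3 k) b21M.
  have /PS : `|2 * (y k.+2 ^+ d + y k.+3 ^+ d + y k.+4 ^+ d)| <= 2 * (S + 2 * T).
    by rewrite ger0_norm; have := Y3 k; have := Y3 k.+1; lra.
  have := Q3 k; have := Q3 k.+1; move: Qk.
  set A := P * _; set B := (z k.+2 ^+ d - _) / _; set C := (z k.+3 ^+ d - _) / _.
  set E := (z k.+4 ^+ d - _) / _ => *.
  have := ler_normD (A + B + C) E; have := ler_normD (A + B) C.
  by have := ler_normD A B; lra.
Qed.

(** * An invariant region and explicit constants for d <= 7 *)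

Definition in_region (R : realFieldType) (s t u : R) (z : nat -> R) :=
  [/\ z 0%N = 1, 2 / 3 <= z 1%N <= u, 0 <= z 2%N <= s &
      forall k, 0 <= z k.+3 <= t].

(** Each upper bound is checked at the worst X_1 in [L, U]: at L for [u] and [t], at U for [s]. The
    lower bound 2 / 3 is the value of (1 + x) / (1 + 2 x) at x = 1. *)
Lemma ratio_step_region (R : realFieldType) (d : nat) (s t u : R) (z : nat -> R) :
  let L := (2 / 3) ^+ d in let S := s ^+ d in let T := t ^+ d in
  let U := u ^+ d in
  2 / 3 <= u <= 1 -> 0 <= t <= s -> s <= 1 / 2 ->
  1 + S - u <= (2 * u - 1) * L -> S <= L ->
  (1 - 2 * s) * U + S + T <= s -> S + 2 * T <= t * (1 + 2 * L) ->
  in_region s t u z -> in_region s t u (ratio_step d z).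
Proof.
move=> L S T U /andP[lu u1] /andP[t0 ts] s2 c1 SL c2 c3 [z0 z1 z2 z3].
have s0 := le_trans t0 ts.
have powle (a v : R) : 0 <= a <= v -> 0 <= a ^+ d <= v ^+ d.
  by move=> /andP[a0 av]; rewrite exprn_ge0 // lerXn2r // nnegrE //; exact: le_trans a0 av.
have Z2 := powle _ _ z2; have Z3 k := powle _ _ (z3 k).
rewrite -/S in Z2; rewrite -/T in Z3.
have Z1 : L <= z 1%N ^+ d <= U.
  have /andP[_ ->] : 0 <= L <= z 1%N ^+ d by apply: powle; lra.
  by have /andP[_ ->] : 0 <= z 1%N ^+ d <= U by apply: powle; lra.
have L0 : 0 <= L by apply: exprn_ge0; lra.
have TS : T <= S by have /andP[] : 0 <= T <= S by apply: powle; lra.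
have U1 : U <= 1 by rewrite exprn_ile1; lra.
have T0 : 0 <= T by apply: exprn_ge0.
have N0 : 0 < 1 + 2 * z 1%N ^+ d by lra.
rewrite /in_region /ratio_step; split => //.
- by rewrite z0 expr1n ler_pdivlMr // ler_pdivrMr //; nra.
- by rewrite divr_ge0 ?ler_pdivrMr //=; have := Z3 0%N; nra.
- move=> k; have Zk : 0 <= z k.+2 ^+ d <= S.
    by case: k => [//|k]; have := Z3 k; lra.
  rewrite divr_ge0 ?ler_pdivrMr //=; have := Z3 k; have := Z3 k.+1; nra.
Qed.

(** By [pow_tangent], w times the left side is at most affine in X = x^(m+1), which leaves a
    quadratic inequality in X. Nothing is lost at x = w, so [w] is best taken near the maximiser. *)
Lemma deriv_bound_of_quadratic (R : realFieldType) (m : nat) (q w : R) : 0 < w ->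
  (forall X : R, 0 <= X -> m%:R * X + w ^+ m.+1 <= w * (q * (1 + 2 * X) ^+ 2)) ->
  forall x : R, 0 <= x -> m.+1%:R * x ^+ m <= q * (1 + 2 * x ^+ m.+1) ^+ 2.
Proof.
move=> w0 quad x x0; rewrite -(ler_pM2l w0).
apply: le_trans (quad _ (exprn_ge0 _ x0)).
by rewrite mulrA [w * _]mulrC; apply: pow_tangent => //; exact: ltW.
Qed.

(* [q] bounds the one-dimensional derivative d x^(d-1) / (1 + 2 x^d)^2; [b1] and [b2]
   bound the influence of the coordinate 2 and of the coordinates >= 3; [c] is the
   contraction factor for the sup norm on the region [in_region s t u]. *)
Definition contracting_region (R : realFieldType) (m : nat) (s t u q b1 b2 c : R) :=
  let d := m.+1 in
  let L := (2 / 3) ^+ d in let S := s ^+ d in let T := t ^+ d in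
  let U := u ^+ d in
  [/\ forall x : R, 0 <= x -> d%:R * x ^+ m <= q * (1 + 2 * x ^+ d) ^+ 2,
      [/\ d%:R * s ^+ m <= b1 * (1 + 2 * L), d%:R * t ^+ m <= b2 * (1 + 2 * L),
          q * (1 + 2 * S) + b1 <= c, q + b1 + b2 <= c &
          2 * (S + 2 * T) * q + b1 + 2 * b2 <= c],
      [/\ 1 + S - u <= (2 * u - 1) * L, S <= L,
          (1 - 2 * s) * U + S + T <= s & S + 2 * T <= t * (1 + 2 * L)] &
      [/\ 0 <= b2 <= b1, 0 <= q & [/\ 0 <= t <= s, 1 / 3 <= s <= 1 / 2,
          2 / 3 <= u <= 1, S + T <= 1 & 0 <= c < 1]]].

(* The derivative is maximal at x^d = (d - 1) / (2 (d + 1)).  In each case the first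
   argument of [quad] approximates this x, the second one approximates x^d, and [q]
   is slightly above the maximum. *)
Lemma contracting_region_exists (R : realFieldType) (m : nat) : (1 <= m <= 6)%N ->
  exists s t u q b1 b2 c : R, contracting_region m s t u q b1 b2 c.
Proof.
(* With the square of X - e as a hypothesis, the quadratic inequality is linear in X and X^2, within
   reach of [lra]. *)
have quad (w q e : R) k : 0 < w ->
    (forall X : R, 0 <= X -> 0 <= (X - e) ^+ 2 ->
       k%:R * X + w ^+ k.+1 <= w * (q * (1 + 2 * X) ^+ 2)) ->
    forall x : R, 0 <= x -> k.+1%:R * x ^+ k <= q * (1 + 2 * x ^+ k.+1) ^+ 2.
  move=> w0 H; apply: (deriv_bound_of_quadratic w0) => X X0.
  by apply: H; rewrite ?sqr_ge0.
case: m => [|[|[|[|[|[|[|m]]]]]]] //= _.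
- exists (37 / 100), (1 / 10), (21 / 25), (23 / 50), (49 / 125), (1059 / 10000), (499 / 500).
  split; [by apply: (quad (41 / 100) _ (163 / 1000)) => [|X]; lra | by split; lra | by split; lra |].
  by split; [lra | lra | split; lra].
- exists (37 / 100), (1 / 10), 1, (53 / 100), (129 / 500), (189 / 10000), (499 / 500).
  split; [by apply: (quad (63 / 100) _ (249 / 1000)) => [|X]; lra | by split; lra | by split; lra |].
  by split; [lra | lra | split; lra].
- exists (37 / 100), (1 / 10), 1, (16 / 25), (73 / 500), (29 / 10000), (499 / 500).
  split; [by apply: (quad (37 / 50) _ (292 / 1000)) => [|X]; lra | by split; lra | by split; lra |].
  by split; [lra | lra | split; lra].
- exists (37 / 100), (1 / 10), 1, (3 / 4), (3 / 40), (1 / 2500), (499 / 500).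
  split; [by apply: (quad (4 / 5) _ (1 / 3)) => [|X]; lra | by split; lra | by split; lra |].
  by split; [lra | lra | split; lra].
- exists (37 / 100), (1 / 10), 1, (87 / 100), (9 / 250), (1 / 10000), (499 / 500).
  split; [by apply: (quad (21 / 25) _ (356 / 1000)) => [|X]; lra | by split; lra | by split; lra |].
  by split; [lra | lra | split; lra].
- exists (17 / 50), (1 / 10), 1, (987 / 1000), (97 / 10000), (1 / 10000), (499 / 500).
  split; [by apply: (quad (87 / 100) _ (374 / 1000)) => [|X]; lra | by split; lra | by split; lra |].
  by split; [lra | lra | split; lra].
Qed.

(** * Geometric convergence of the ratios for d <= 7 *)

Lemma root_ratio_ge0 (R : realFieldType) d n k : 0 <= root_ratio R d n k.
Proof.
elim: n k => [|n IH] [|k] //=.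
by rewrite divr_ge0 ?addr_ge0 ?mulr_ge0 ?exprn_ge0.
Qed.

Lemma root_ratio_eq0 (R : realFieldType) d n k : (0 < d)%N -> (n < k)%N -> root_ratio R d n k = 0.
Proof.
move=> d0; have E0 : 0 ^+ d = 0 :> R by rewrite expr0n gtn_eqF.
elim: n k => [|n IH] [|k] //=; rewrite ltnS => nk.
by rewrite (IH k) ?(IH k.+1) ?(IH k.+2) ?E0 ?addr0 ?mul0r //; lia.
Qed.

(** The values at time 2 are 1, 2 / 3, 1 / 3, 0, ... Time 1 is too early: there coordinate 1 equals
    1, above the [u] chosen for d = 2. *)
Lemma root_ratio2_region (R : realFieldType) d (s t u : R) : (0 < d)%N ->
  0 <= t <= s -> 1 / 3 <= s -> 2 / 3 <= u -> in_region s t u (root_ratio R d 2).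
Proof.
move=> d0 /andP[t0 ts] s3 u3.
have E0 : 0 ^+ d = 0 :> R by rewrite expr0n gtn_eqF.
have E1 k : root_ratio R d 1 k = (k <= 1)%:R.
  by case: k => [|[|k]] //=; rewrite ?E0 ?expr1n ?mulr0 ?addr0 ?divr1 ?mul0r.
rewrite -[root_ratio R d 2]/(ratio_step d (root_ratio R d 1)) /ratio_step.
have E3 : 1 + 2 * 1 = 3 :> R by ring.
split; rewrite ?E1 //= ?expr1n ?E0 ?E3; [lra | lra |].
by move=> k; rewrite !addr0 mul0r E0 !addr0 mul0r lexx.
Qed.

(** As in the binomial expansion, n h c^n <= (c + h)^n with h = (1 - c) / 2: a linear factor costs
    only a larger base. The factor n + 3 will count coordinates. *)
Lemma linear_geometric_le (R : realFieldType) (c : R) : 0 <= c < 1 ->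
  exists D e : R, [/\ 0 <= D, 0 <= e < 1 & forall n, (n + 3)%:R * c ^+ n <= D * e ^+ n].
Proof.
move=> /andP[c0 c1]; pose h := (1 - c) / 2.
have h0 : 0 < h by rewrite /h; lra.
have ce n : c ^+ n <= (c + h) ^+ n by apply: lerXn2r; rewrite ?nnegrE; lra.
have H n : n%:R * h * c ^+ n <= (c + h) ^+ n.
  elim: n => [|n IH]; first by rewrite !mul0r exprn_ge0 //; lra.
  have := ler_wpM2l c0 IH; have := ler_wpM2l (ltW h0) (ce n).
  have := ler_wpM2l c0 (ce n); have cn := exprn_ge0 n c0.
  have := ler_wpM2r cn (ltW c1); rewrite -natr1 !exprS => A B C D.
  have := ler_wpM2l (ltW h0) A; lra.
exists (h^-1 + 3), (c + h); split; [|rewrite /h; lra|].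
  by rewrite addr_ge0 // invr_ge0 ltW.
move=> n; have cn := H n; rewrite natrD mulrDl [leRHS]mulrDl; apply: lerD.
  by rewrite -(ler_pM2l h0) [leRHS]mulrA divff ?gt_eqF // mul1r mulrA [h * _]mulrC.
by rewrite ler_wpM2l.
Qed.

Lemma cvg_geometric_rate (R : realType) (u : nat -> R) (l C c : R) (k : nat) :
  0 <= c < 1 -> (forall n, `|u (n + k)%N - l| <= C * c ^+ n) -> u @ \oo --> l.
Proof.
move=> /andP[c0 c1] uC; rewrite -(cvg_shiftn k).
apply/cvgrPdist_le => e e0.
have : (fun n => C * c ^+ n) @ \oo --> C * 0.
  by apply: cvgMr; apply: cvg_expr; rewrite ger0_norm.
rewrite mulr0 => /cvgrPdist_le/(_ e e0); apply: filterS => n.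
rewrite sub0r normrN distrC => h; apply: le_trans (uC n) _.
exact: le_trans (ler_norm _) h.
Qed.

Lemma root_ratio_increments (R : realType) d : (2 <= d <= 7)%N ->
  exists2 c : R, 0 <= c < 1 & forall n,
    (forall k, root_ratio R d n.+2 k <= 1) /\
    (forall k, `|root_ratio R d n.+3 k - root_ratio R d n.+2 k| <= c ^+ n).
Proof.
case: d => [//|m] m6; have [] := @contracting_region_exists R m; first by lia.
move=> s [t [u [q [b1 [b2 [c [dq [b1L b2L c1 c2 c3] [r1 r2 r3 r4] h]]]]]]].
have [b12 q0 [ts s1 u1 ST c01]] := h.
have [t0 s3 s2 u2 u3] : [/\ 0 <= t <= 1, 1 / 3 <= s, s <= 1 / 2, 2 / 3 <= u & u <= 1].
  by split; lra.
exists c => //.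
have reg n : in_region s t u (root_ratio R m.+1 n.+2).
  elim: n => [|n IH]; first exact: root_ratio2_region.
  exact: (ratio_step_region u1 ts s2 r1 r2 r3 r4 IH).
have le1 n k : root_ratio R m.+1 n.+2 k <= 1.
  by have [z0 z1 z2 z3] := reg n; case: k => [|[|[|k]]]; rewrite ?z0 //; last have := z3 k; lra.
move=> n; split; first exact: le1.
elim: n => [|n IH] k.
  rewrite expr0 ler_norml; have := root_ratio_ge0 R m.+1 2 k.
  by have := root_ratio_ge0 R m.+1 3 k; have := le1 0%N k; have := le1 1%N k; lra.
have [z0 /andP[z1 _] z2 z3] := reg n; have [y0 /andP[y1 _] y2 y3] := reg n.+1.
rewrite exprS; apply: (ratio_step_contract dq b1L b2L _ b12 q0 c1 c2 c3 ts ST) => //.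
Qed.

(** That [S] is both the limit of the sums and the sum of the limits says that no mass escapes. At
    time n the coordinates beyond n vanish, so the sums change by O(n c^n). *)
Lemma root_ratio_limit (R : realType) d : (2 <= d <= 7)%N ->
  exists (zeta : nat -> R) (S : R),
  [/\ forall k, (fun n => root_ratio R d n k) @ \oo --> zeta k,
      (fun n => \sum_(k < n) root_ratio R d n k.+1 ^+ d) @ \oo --> S &
      (fun n => \sum_(k < n) zeta k.+1 ^+ d) @ \oo --> S].
Proof.
case: d => [//|m] d27.
have [c c01 H] := root_ratio_increments R d27.
have /andP[c0 c1] := c01.
have /choice[zeta zetaP] : forall k, exists l, forall n,
    `|root_ratio R m.+1 n.+2 k - l| <= 1 / (1 - c) * c ^+ n.
  move=> k; apply: (geometric_increments (u := fun n => root_ratio R m.+1 n.+2 k)) => //.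
  by move=> n; rewrite mul1r; exact: (H n).2.
have cvg2 k : (fun n => root_ratio R m.+1 n.+2 k) @ \oo --> zeta k.
  by apply: (cvg_geometric_rate (k := 0) c01) => n; rewrite addn0; exact: zetaP.
have rho01 n k : 0 <= root_ratio R m.+1 n.+2 k <= 1.
  by rewrite root_ratio_ge0 (H n).1.
have zeta01 k : 0 <= zeta k <= 1.
  apply/andP; split; [apply: cvgr_to_ge (cvg2 k) _ | apply: cvgr_to_le (cvg2 k) _];
    by apply: nearW => n; have /andP[] := rho01 n k.
have [D [e [D0 e01 De]]] := linear_geometric_le c01.
pose d := m.+1%:R : R; have d0 : 0 <= d by [].
have diff_le (f g : nat -> R) n j B : (forall k, 0 <= f k <= 1) -> (forall k, 0 <= g k <= 1) ->
    (j <= n + 3)%N -> 0 <= B -> (forall k, `|f k - g k| <= B * c ^+ n) ->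
    `|\sum_(k < j) f k.+1 ^+ m.+1 - \sum_(k < j) g k.+1 ^+ m.+1| <= d * B * D * e ^+ n.
  move=> f01 g01 jn B0 fg; rewrite -sumrB; apply: le_trans (ler_norm_sum _ _ _) _.
  have term k : `|f k ^+ m.+1 - g k ^+ m.+1| <= d * B * c ^+ n.
    apply: le_trans (pow_lip m (f01 k) (g01 k)) _.
    by rewrite expr1n mulr1 -mulrA ler_wpM2l.
  apply: (@le_trans _ _ (\sum_(k < j) d * B * c ^+ n)).
    by apply: ler_sum => k _; exact: term.
  rewrite sumr_const card_ord -mulr_natr -!mulrA ler_wpM2l // ler_wpM2l //.
  apply: le_trans (De n); rewrite mulrC ler_wpM2r ?exprn_ge0 //.
  by rewrite ler_nat.
pose Sn n : R := \sum_(k < n) root_ratio R m.+1 n k.+1 ^+ m.+1.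
have Sn_inc n : `|Sn n.+3 - Sn n.+2| <= d * 1 * D * e ^+ n.
  (* The added term is coordinate [n.+3] at time [n.+2], which vanishes; both sums then have [n.+3]
     terms. *)
  have -> : Sn n.+2 = \sum_(k < n.+3) root_ratio R m.+1 n.+2 k.+1 ^+ m.+1.
    rewrite [RHS]big_ord_recr [X in _ = _ + X](_ : _ = 0) ?addr0 //.
    by rewrite root_ratio_eq0 // expr0n.
  apply: diff_le => // [|k]; first by rewrite addn3.
  by rewrite mul1r; exact: (H n).2.
have [S SnS] := geometric_increments (u := fun n => Sn n.+2) (mulr_ge0 (mulr_ge0 d0 ler01) D0) e01 Sn_inc.
exists zeta, S; split.
- by move=> k; apply: (cvg_geometric_rate (k := 2) c01) => n; rewrite addn2; exact: zetaP.
- by apply: (cvg_geometric_rate (k := 2) e01) => n; rewrite addn2; exact: SnS.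
(* The first part of [C] compares the partial sum of [zeta] with [Sn n.+2], the second one [Sn n.+2]
   with [S]. *)
apply: (cvg_geometric_rate (k := 2) (C := d * (1 / (1 - c)) * D + d * 1 * D / (1 - e)) e01) => n.
rewrite addn2 -[X in `|X - S|](subrK (Sn n.+2)) -addrA mulrDl.
apply: le_trans (ler_normD _ _) (lerD _ (SnS n)).
apply: diff_le => //.
- by rewrite addn3.
- by rewrite divr_ge0 // subr_ge0 ltW.
- by move=> k; rewrite distrC; exact: zetaP.
Qed.

(** * Oscillation of the first coordinate for d >= 8 *)

Lemma bernoulli (R : realDomainType) (x : R) n : 0 <= x -> 1 + n%:R * x <= (1 + x) ^+ n.
Proof.
move=> x0; elim: n => [|n IH]; first by rewrite mul0r addr0 expr0.
have := ler_wpM2l (addr_ge0 ler01 x0) IH; rewrite exprS -natr1.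
have := mulr_ge0 (mulr_ge0 (ler0n R n) x0) x0; lra.
Qed.

(** The two inequalities make X_1 <= b and X_1 >= 2 / 5 follow each other in turn. Induction on d
    from 8, where [b] is multiplied by 389 / 500 at each step. *)
Lemma oscillation_bound (R : realFieldType) d : (8 <= d)%N ->
  exists2 b : R, 0 <= b < 2 / 5 &
    (389 / 500) ^+ d <= b /\
    2 / 5 <= ((1 + b) / (1 + 2 * b)) ^+ d.
Proof.
move=> d8.
suff [b [b0 H1 H2]] : exists b : R, [/\ 0 <= b <= 1 / 7,
    (389 / 500) ^+ d <= b & 2 / 5 <= ((1 + b) / (1 + 2 * b)) ^+ d].
  by exists b; [lra | split].
elim: d d8 => [//|d IH]; rewrite leq_eqVlt => /orP[/eqP <-|].
  (* Just above (389 / 500)^8, which is about 0.1342. *)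
  exists (27 / 200); split; [lra|lra|].
  have -> : (1 + 27 / 200) / (1 + 2 * (27 / 200)) = 227 / 254 :> R by field.
  by lra.
rewrite ltnS => d8; have [b [b01 H1 H2]] := IH d8.
pose r : R := 389 / 500; exists (r * b).
have r0 : 0 <= r by rewrite /r; lra.
split; [rewrite /r; lra| |].
  by rewrite exprS -/r; exact: ler_wpM2l r0 _ _ H1.
set p := (1 + b) / (1 + 2 * b) in H2; set p' := (1 + r * b) / _.
have p0 : 0 < p by rewrite divr_gt0; lra.
have p'0 : 0 < p' by rewrite divr_gt0 /r; lra.
(* Passing from b to r b multiplies the base p by 1 + x; by Bernoulli with d >= 8, (1 + x)^d makes
   up for the extra factor p'. *)
pose x := (1 - r) * b / ((1 + 2 * r * b) * (1 + b)).
have x0 : 0 <= x by rewrite divr_ge0 // /r; nra.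
have pE : p' = p * (1 + x).
  rewrite /p /p' /x; field; rewrite /r; apply/and3P; split; apply/eqP; lra.
have h8 : 1 <= (1 + 8 * x) * p'.
  have -> : (1 + 8 * x) * p' = 1 + (8 * (1 - r) * (1 + r * b) - r * (1 + 2 * r * b) * (1 + b)) * b
      / ((1 + 2 * r * b) ^+ 2 * (1 + b)).
    rewrite /p' /x; field; rewrite /r; apply/andP; split; apply/eqP; lra.
  rewrite lerDl divr_ge0 //; rewrite /r; nra.
have hd : 1 + 8 * x <= (1 + x) ^+ d.
  apply: le_trans (bernoulli d x0); rewrite lerD2l ler_wpM2r //.
  by rewrite ler_nat.
apply: (le_trans H2); rewrite exprS {2}pE [(p * _) ^+ d]exprMn mulrCA ler_peMr //; first by rewrite exprn_ge0 // ltW.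
by apply: (le_trans h8); rewrite mulrC ler_wpM2l // ltW.
Qed.

Lemma first_ratio_lower (R : realFieldType) (b X Y : R) :
  0 <= X <= b -> 0 <= Y -> (1 + b) / (1 + 2 * b) <= (1 + X + Y) / (1 + 2 * X).
Proof.
move=> /andP[X0 Xb] Y0; rewrite ler_pdivrMr; last by lra.
by rewrite mulrAC ler_pdivlMr; [nra | lra].
Qed.

(** The quotient increases in Y, and at Y = 1 / 2500 it decreases in X; 389 / 500 is its value at X
    = 2 / 5, Y = 1 / 2500. *)
Lemma first_ratio_upper (R : realFieldType) (X Y : R) :
  2 / 5 <= X -> Y <= 1 / 2500 -> (1 + X + Y) / (1 + 2 * X) <= 389 / 500.
Proof. by move=> X0 Y0; rewrite ler_pdivrMr; lra. Qed.

(** The region with s = t = 34 / 100 and u = 1, entered at time 1, gives X_2 <= (34 / 100)^8 <= 1 /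
    2500. So X_1 nearly follows the one-dimensional map, starting from 0. *)
Lemma root_ratio_oscillates (R : realFieldType) d : (8 <= d)%N ->
  exists2 b : R, b < 2 / 5 & forall n,
    root_ratio R d n.*2 1 ^+ d <= b /\ 2 / 5 <= root_ratio R d n.*2.+1 1 ^+ d.
Proof.
move=> d8; have d0 : (0 < d)%N by lia.
have [b /andP[b0 b1] [hb ha]] := oscillation_bound R d8.
have E0 : 0 ^+ d = 0 :> R by rewrite expr0n gtn_eqF.
have S8 : (34 / 100) ^+ d <= 1 / 2500 :> R.
  apply: (@le_trans _ _ ((34 / 100) ^+ 8)); last by lra.
  by apply: ler_wiXn2l => //; lra.
have SL : (34 / 100) ^+ d <= (2 / 3) ^+ d :> R by apply: lerXn2r; rewrite ?nnegrE; lra.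
have reg n : in_region (34 / 100) (34 / 100) (1 : R) (root_ratio R d n.+1).
  elim: n => [|n IH].
    split=> //=; rewrite ?E0 ?expr1n ?mulr0 ?addr0 ?divr1 ?mul0r; [lra|lra|].
    by move=> k; lra.
  have L0 : 0 <= (2 / 3) ^+ d :> R by apply: exprn_ge0; lra.
  by apply: ratio_step_region IH; rewrite ?expr1n; lra.
exists b => // n.
have up_odd m : root_ratio R d m 1 ^+ d <= b -> 2 / 5 <= root_ratio R d m.+1 1 ^+ d.
  set X := _ ^+ d => Xb; apply: (le_trans ha).
  have X0 : 0 <= X by rewrite exprn_ge0 // root_ratio_ge0.
  have Y0 : 0 <= root_ratio R d m 2 ^+ d by rewrite exprn_ge0 // root_ratio_ge0.
  have z0 : root_ratio R d m 0 = 1 by case: (m).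
  rewrite -[root_ratio R d m.+1]/(ratio_step d (root_ratio R d m)) /ratio_step z0.
  rewrite expr1n -/X; apply: lerXn2r; last by apply: first_ratio_lower; rewrite ?X0.
    by rewrite nnegrE divr_ge0 //; lra.
  by rewrite nnegrE divr_ge0 ?addr_ge0 ?mulr_ge0.
have low_even m : 2 / 5 <= root_ratio R d m.+1 1 ^+ d -> root_ratio R d m.+2 1 ^+ d <= b.
  rewrite -[root_ratio R d m.+2]/(ratio_step d (root_ratio R d m.+1)) /ratio_step.
  have [-> _ z2 _] := reg m; set X := _ 1%N ^+ d; set Y := _ 2%N ^+ d => Xb.
  apply: le_trans hb.
  have Y0 : 0 <= Y by rewrite exprn_ge0 // root_ratio_ge0.
  have Y8 : Y <= 1 / 2500.
    by apply: le_trans S8; apply: lerXn2r; rewrite ?nnegrE; lra.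
  have X0 : 0 <= X by rewrite exprn_ge0 // root_ratio_ge0.
  rewrite expr1n; apply: lerXn2r; last exact: first_ratio_upper.
    by rewrite nnegrE divr_ge0 ?addr_ge0 ?mulr_ge0.
  by rewrite nnegrE; lra.
suff even : root_ratio R d n.*2 1 ^+ d <= b by split=> //; exact: up_odd.
elim: n => [|n IH]; first by rewrite /= E0.
by rewrite doubleS; apply: low_even; apply: up_odd.
Qed.

(** * Counting Lipschitz functions by branching at the root *)

(* Junk value: the root, when the word is longer than [n]. *)
Definition mkvert d n (s : seq 'I_d) : vert n d :=
  if @idP (size s < n.+1)%N is ReflectT H then
    Tagged (fun k : 'I_n.+1 => k.-tuple 'I_d) (in_tuple s : (Ordinal H).-tuple 'I_d)
  else Tagged (fun k : 'I_n.+1 => k.-tuple 'I_d)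
         ([tuple] : (ord0 : 'I_n.+1).-tuple 'I_d).

Lemma vseq_mkvert d n (s : seq 'I_d) : (size s <= n)%N -> vseq (mkvert n s) = s.
Proof. by move=> sn; rewrite /vseq /mkvert; case: {-}_ / idP. Qed.

Lemma size_vseq d n (v : vert n d) : (size (vseq v) <= n)%N.
Proof. by case: v => k s; rewrite /vseq /= size_tuple -ltnS. Qed.

Lemma vseq_inj d n : injective (@vseq n d).
Proof.
move=> [[k kn] s] [[l ln] t]; rewrite /vseq /= => st.
have kl : k = l by have /= := size_tuple s; rewrite st size_tuple.
subst l; move: t st; rewrite (bool_irrelevance ln kn) => t st.
by congr existT; apply: val_inj.
Qed.

Lemma vseqK d n (v : vert n d) : mkvert n (vseq v) = v.
Proof. by apply: vseq_inj; rewrite vseq_mkvert // size_vseq. Qed.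

Definition root_val d n (f : {ffun vert n d -> int}) : int := f (mkvert n [::]).

Definition branch d n (i : 'I_d) (f : {ffun vert n.+1 d -> int}) :
    {ffun vert n d -> int} :=
  [ffun v => f (mkvert n.+1 (i :: vseq v))].

Definition graft d n (k : int) (g : 'I_d -> {ffun vert n d -> int}) :
    {ffun vert n.+1 d -> int} :=
  [ffun v => if vseq v is i :: s then g i (mkvert n s) else k].

Lemma root_val_graft d n k (g : 'I_d -> {ffun vert n d -> int}) :
  root_val (graft k g) = k.
Proof. by rewrite /root_val ffunE vseq_mkvert. Qed.

Lemma branch_graft d n k (g : 'I_d -> {ffun vert n d -> int}) i :
  branch i (graft k g) = g i.
Proof.
by apply/ffunP => v; rewrite !ffunE vseq_mkvert /= ?vseqK // ltnS size_vseq.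
Qed.

Lemma graft_branch d n (f : {ffun vert n.+1 d -> int}) :
  graft (root_val f) (fun i => branch i f) = f.
Proof.
apply/ffunP => v; rewrite ffunE; case E: (vseq v) => [|i s].
  by rewrite /root_val -[v]vseqK E.
have sn : (size s <= n)%N by have := size_vseq v; rewrite E.
by rewrite ffunE vseq_mkvert // -E vseqK.
Qed.

Lemma eq_tree d n (f g : {ffun vert n.+1 d -> int}) :
  root_val f = root_val g -> (forall i, branch i f = branch i g) -> f = g.
Proof.
move=> fg0 fg; rewrite -[f]graft_branch -[g]graft_branch fg0.
by apply/ffunP => v; rewrite !ffunE; case: (vseq v) => // i s; rewrite fg.
Qed.

(** The edges are those at the root and those inside the branches; a leaf at depth [n.+1] has depth
    [n] in its branch. *)
Lemma L0_branchP d n (f : {ffun vert n.+1 d -> int}) :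
  L0 f <-> forall i, L0 (branch i f) /\ `|root_val f - root_val (branch i f)| <= 1.
Proof.
split=> [[lf f0] i|H].
  split; first split.
  - move=> u v [j uv]; rewrite !ffunE; apply: lf; exists j.
    by rewrite !vseq_mkvert ?uv //= ltnS -?uv size_vseq.
  - move=> v vn; rewrite ffunE; apply: f0.
    by rewrite /depth vseq_mkvert /= ?ltnS ?size_vseq // -[size _]/(depth v) vn.
  - rewrite /root_val ffunE vseq_mkvert //; apply: lf; exists i.
    by rewrite !vseq_mkvert.
split=> [u v [j uv]|v vn].
  case E: (vseq u) => [|i s].
    have -> : u = mkvert n.+1 [::] by rewrite -E vseqK.
    have -> : v = mkvert n.+1 [:: j] by rewrite -[v]vseqK uv E.
    have [_] := H j; rewrite /root_val ffunE vseq_mkvert //.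
  have := size_vseq v; rewrite uv E /= ltnS => sn.
  have -> : v = mkvert n.+1 (i :: vseq (mkvert n (rcons s j))).
    by rewrite vseq_mkvert // -[v]vseqK uv E.
  have sn' : (size s <= n)%N by move: sn; rewrite size_rcons; apply: ltnW.
  have -> : u = mkvert n.+1 (i :: vseq (mkvert n s)).
    by rewrite vseq_mkvert // -[u]vseqK E.
  have [[+ _] _] := H i.
  move=> /(_ (mkvert n s) (mkvert n (rcons s j))); rewrite !ffunE; apply.
  by exists j; rewrite !vseq_mkvert.
move: vn; rewrite /depth; case E: (vseq v) => [//|i s] [sn].
have -> : v = mkvert n.+1 (i :: vseq (mkvert n s)).
  by rewrite vseq_mkvert ?sn // -E vseqK.
have [[_ f0] _] := H i.
by have := f0 (mkvert n s); rewrite ffunE; apply; rewrite /depth vseq_mkvert ?sn.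
Qed.

Lemma cyl_root d n r (h : {ffun vert r d -> int}) f :
  cyl h f -> root_val (n := n) f = root_val h.
Proof. by move=> [_ fh]; apply: fh; rewrite !vseq_mkvert. Qed.

Lemma cyl0P d n (h : {ffun vert 0 d -> int}) f :
  cyl (n := n) h f <-> L0 f /\ root_val f = root_val h.
Proof.
split=> [fh|[Lf fh]]; first by split; [case: fh | exact: cyl_root fh].
split=> // v w vw.
have w0 : vseq w = [::] by apply: size0nil; have := size_vseq w; case: (size _).
by rewrite -[v]vseqK -[w]vseqK vw w0.
Qed.

Lemma cyl_branchP d n r (h : {ffun vert r.+1 d -> int}) f :
  cyl (n := n.+1) h f <->
  [/\ root_val f = root_val h,
      forall i, cyl (branch i h) (branch i f) &
      forall i, `|root_val h - root_val (branch i h)| <= 1].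
Proof.
split=> [fh|[f0 fi hi]].
  have [/L0_branchP Lf fE] := fh.
  have hb i : cyl (branch i h) (branch i f).
    split=> [|v w vw]; first by case: (Lf i).
    rewrite !ffunE; apply: fE.
    by rewrite !vseq_mkvert ?vw //= ltnS ?size_vseq // -vw size_vseq.
  split=> // [|i]; first exact: cyl_root fh.
  by rewrite -(cyl_root fh) -(cyl_root (hb i)); case: (Lf i).
split.
  apply/L0_branchP => i; split; first by case: (fi i).
  by rewrite f0 (cyl_root (fi i)).
move=> v w vw; rewrite -[f]graft_branch -[h]graft_branch !ffunE vw.
case E: (vseq w) => [//|i s]; have [_ hE] := fi i.
have := size_vseq v; have := size_vseq w; rewrite vw E /= !ltnS => ??.
by apply: hE; rewrite !vseq_mkvert.
Qed.

(** * Numbers of admissible functions with a given root value *)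

Lemma card_family_fset (T : choiceType) (I : finType) (U : {fset T})
    (B : I -> {fset T}) : (forall i, B i `<=` U)%fset ->
  #|(family (fun i => [pred u : U | fsval u \in B i]) : pred {ffun I -> U})|
  = (\prod_i #|` B i|)%N.
Proof.
move=> BU; rewrite card_family foldrE big_map big_enum; apply: eq_bigr => i _.
rewrite -(card_fsub (BU i)); apply: eq_card => u.
by rewrite !inE.
Qed.

(** By [graft], a function with root value [k] is a free choice of [d] branches. They are chosen in
    one finite type [U] containing every [B i]. *)
Lemma finite_card_branch d n (k : int) (B : 'I_d -> {fset {ffun vert n d -> int}})
    (A := [set f : {ffun vert n.+1 d -> int} |
             root_val f = k /\ forall i, branch i f \in B i]%classic) :
  finite_set A /\ #|` fset_set A| = (\prod_i #|` B i|)%N.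
Proof.
pose U := (\bigcup_(i <- enum 'I_d) B i)%fset.
have BU i : (B i `<=` U)%fset by apply: bigfcup_sup; rewrite ?mem_enum.
pose P : pred {ffun 'I_d -> U} :=
  family (fun i => [pred u : U | fsval u \in B i]).
pose F (g : {ffun 'I_d -> U}) := graft k (fun i => fsval (g i)).
pose C := [fset F g | g in P]%fset.
have -> : A = [set` C]%classic.
  apply/seteqP; split => f /=.
    move=> [f0 fB].
    pose g := [ffun i => [` fsubsetP (BU i) _ (fB i)]%fset] : {ffun 'I_d -> U}.
    apply/imfsetP; exists g => /=.
      by apply/familyP => i; rewrite inE ffunE /= fB.
    by apply: eq_tree => [|i]; rewrite ?root_val_graft ?branch_graft // ffunE.
  move=> /imfsetP[g /= /familyP gP ->]; split; first exact: root_val_graft.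
  by move=> i; rewrite branch_graft; have := gP i; rewrite inE.
split; first exact: finite_fset.
rewrite set_fsetK -(card_family_fset BU) card_imfset /=; last first.
  move=> g g' gg; apply/ffunP => i; apply: val_inj.
  by rewrite /= -[LHS](branch_graft k (fun i => fsval (g i))) -[graft _ _]/(F g) gg branch_graft.
by rewrite -cardE.
Qed.

(** This is a_n(k) for k >= 0. By the symmetry f -> -f, the values -1 and 1 have equal counts,
    whence the factor 2. *)
Fixpoint root_count (d n k : nat) : nat :=
  if n is m.+1 then
    if k is j.+1 then
      ((root_count d m j + root_count d m j.+1 + root_count d m j.+2) ^ d)%N
    else ((root_count d m 0 + 2 * root_count d m 1) ^ d)%N
  else (k == 0)%N.

Definition L0_at d n (k : int) : set {ffun vert n d -> int} :=
  [set f | L0 f /\ root_val f = k]%classic.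

Arguments L0_at : clear implicits.

Lemma L0_at0 d (k : int) :
  L0_at d 0 k = [set` if k == 0 then [fset [ffun=> 0]]%fset else fset0]%classic.
Proof.
have L00 (f : {ffun vert 0 d -> int}) : L0 f <-> f = [ffun=> 0].
  split=> [[_ f0]|->].
    apply/ffunP => v; rewrite ffunE f0 //.
    by have := size_vseq v; rewrite /depth; case: size.
  split=> [u v _|v _]; by rewrite !ffunE ?subrr ?normr0.
apply/seteqP; split => f /=.
  by move=> [/L00 -> <-]; rewrite /root_val ffunE eqxx inE.
case: eqP => [->|_]; last by rewrite inE.
by rewrite inE => /eqP ->; split; [exact/L00 | rewrite /root_val ffunE].
Qed.

(** Each branch independently takes a root value among k - 1, k, k + 1, whence the d-th power of a
    sum of three counts. *)
Lemma card_L0_at d n (k : int) :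
  finite_set (L0_at d n k) /\ #|` fset_set (L0_at d n k)| = root_count d n `|k|.
Proof.
elim: n k => [|n IH] k.
  rewrite L0_at0; split; first exact: finite_fset.
  rewrite set_fsetK /= absz_eq0.
  by case: eqP => _; rewrite ?cardfs1 ?cardfs0.
have fin j : finite_set (L0_at d n j) by case: (IH j).
pose B := (fset_set (L0_at d n (k - 1)) `|` fset_set (L0_at d n k)
           `|` fset_set (L0_at d n (k + 1)))%fset.
have inB f : f \in B <-> L0 f /\ `|k - root_val f| <= 1.
  rewrite !inE !in_fset_set //; split.
    move=> /orP[/orP[]|] /set_mem [Lf ->]; split=> //; lia.
  move=> [Lf fk].
  have [E|E|E] : [\/ root_val f = k - 1, root_val f = k | root_val f = k + 1].
  - have [|] : root_val f < k \/ k <= root_val f by lia.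
      by move=> ?; constructor 1; lia.
    move=> ?; have [?|?] : root_val f = k \/ root_val f = k + 1 by lia.
      by constructor 2.
    by constructor 3.
  - by apply/orP; left; apply/orP; left; apply/mem_set.
  - by apply/orP; left; apply/orP; right; apply/mem_set.
  - by apply/orP; right; apply/mem_set.
have -> : L0_at d n.+1 k =
    [set f | root_val f = k /\ forall i, branch i f \in B]%classic.
  apply/seteqP; split => f /=.
    by move=> [/L0_branchP Lf fk]; split=> // i; apply/inB; rewrite -fk.
  by move=> [fk fB]; split=> //; apply/L0_branchP => i; rewrite fk; apply/inB.
have [finA ->] := finite_card_branch k (fun=> B); split=> //.
rewrite prod_nat_const card_ord.
have -> : #|` B| = (root_count d n (absz (k - 1)%R) + root_count d n (absz k)
                    + root_count d n (absz (k + 1)%R))%N.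
  have disj (i j : int) : i != j ->
      (fset_set (L0_at d n i) `&` fset_set (L0_at d n j) = fset0)%fset.
    move=> ij; apply/eqP/fset0Pn => -[f]; rewrite inE !in_fset_set //.
    by move=> /andP[/set_mem[_ fi] /set_mem[_ fj]]; move: ij; rewrite -fi fj eqxx.
  rewrite /B cardfsU fsetIUl !disj ?fsetU0 ?cardfs0 ?subn0; [|lia|lia].
  by rewrite cardfsU disj; [rewrite cardfs0 subn0 !(IH _).2 | lia].
case: k {B inB finA} => [[|k]|k].
- have -> : absz (Posz 0 - 1)%R = 1%N by [].
  have -> : absz (Posz 0 + 1)%R = 1%N by [].
  by rewrite /=; congr (_ ^ _)%N; lia.
- have -> : absz (Posz k.+1 - 1)%R = k by lia.
  by have -> : absz (Posz k.+1 + 1)%R = k.+2 by lia.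
- have -> : absz (Negz k - 1)%R = k.+2 by lia.
  have -> : absz (Negz k + 1)%R = k by lia.
  by rewrite /=; congr (_ ^ _)%N; lia.
Qed.

Lemma L0_bound d n (f : {ffun vert n d -> int}) (s : seq 'I_d) :
  L0 f -> (size s <= n)%N -> `|f (mkvert n s) - root_val f| <= (size s)%:Z.
Proof.
move=> [Lf _]; elim/last_ind: s => [|s i IH] sn; first by rewrite subrr.
rewrite size_rcons in sn *; have := IH (ltnW sn).
have : `|f (mkvert n s) - f (mkvert n (rcons s i))| <= 1.
  by apply: Lf; exists i; rewrite !vseq_mkvert ?size_rcons // ltnW.
lia.
Qed.

Lemma root_count_gt0 d n : (0 < root_count d n 0)%N.
Proof. by elim: n => // n IH /=; rewrite expn_gt0 addn_gt0 IH. Qed.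

(** Windows of three counts are compared; the window at 0 contains a_n(1) twice, and a_n(2) <=
    a_n(1). It makes 0 the most likely root value. *)
Lemma root_count_nincr d n k : (root_count d n k.+1 <= root_count d n k)%N.
Proof.
have mono a b : (a <= b -> a ^ d <= b ^ d)%N.
  by case: d => // e ab; rewrite leq_exp2r.
elim: n k => [//|n IH] [|k] /=; apply: mono.
  by have := IH 0%N; have := IH 1%N; lia.
by have := IH k; have := IH k.+1; have := IH k.+2; lia.
Qed.

(** * Cardinalities of cylinders and of the whole space *)

Local Open Scope fset_scope.

Lemma card_fset_sep (T : choiceType) (F : {fset T}) (P : pred T) :
  #|` [fset f in F | P f]| = (\sum_(f <- F) P f)%N.
Proof. by rewrite card_fset_sum1 -big_fset_condE big_mkcond. Qed.

Lemma card_fset_fibers (T U : choiceType) (F : {fset T}) (H : {fset U}) (p : T -> U) :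
  (\sum_(h <- H) #|` [fset f in F | p f == h]|)%N = #|` [fset f in F | p f \in H]|.
Proof.
rewrite card_fset_sep; under eq_bigr do rewrite card_fset_sep.
rewrite exchange_big /=; apply: eq_bigr => f _.
rewrite -(count_uniq_mem _ (fset_uniq H)) -sum1_count [RHS]big_mkcond /=.
by apply: eq_bigr => h _; rewrite eq_sym; case: eqP.
Qed.

Fixpoint int_ball (K : nat) : {fset int} :=
  if K is k.+1 then k.+1%:Z |` (- k.+1%:Z |` int_ball k) else [fset 0].

Lemma in_int_ball K (i : int) : (i \in int_ball K) = (`|i| <= K)%N.
Proof.
elim: K => [|K IH] /=; first by rewrite inE leqn0 absz_eq0.
rewrite !inE IH; apply/idP/idP; lia.
Qed.

(** The counts summed over root values in [-K, K], folded by symmetry; for d > 0, K = n gives the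
    size of [L0]. *)
Definition ball_count (d n K : nat) : nat :=
  (root_count d n 0 + 2 * \sum_(k < K) root_count d n k.+1)%N.

Lemma sum_int_ball d n K :
  (\sum_(i <- int_ball K) root_count d n `|i|)%N = ball_count d n K.
Proof.
rewrite /ball_count; elim: K => [|K IH] /=.
  by rewrite big_seq_fset1 big_ord0 muln0 addn0.
rewrite big_fsetU1 ?big_fsetU1 /= ?inE ?in_int_ball ?IH ?big_ord_recr /= ?abszN; lia.
Qed.

Lemma L0_root_bound d n (f : {ffun vert n d -> int}) :
  (0 < d)%N -> L0 f -> `|root_val f| <= n%:Z.
Proof.
(* The word repeating the first letter [n] times leads to a leaf. *)
move=> d0 Lf; have sn : size (nseq n (Ordinal d0)) = n by rewrite size_nseq.
have := L0_bound Lf (eq_leq sn); rewrite (Lf.2 _); last first.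
  by rewrite /depth vseq_mkvert sn.
by rewrite sn; lia.
Qed.

Lemma finite_L0 d n : (0 < d)%N -> finite_set (@L0 n d).
Proof.
move=> d0.
apply: (@sub_finite_set _ _ (\bigcup_(k in [set` int_ball n]) L0_at d n k)%classic).
  by move=> f Lf; exists (root_val f) => //=; rewrite in_int_ball; have := L0_root_bound d0 Lf; lia.
by apply: bigcup_finite => [|k _]; [exact: finite_fset | case: (card_L0_at d n k)].
Qed.

Lemma finite_cyl d n r (h : {ffun vert r d -> int}) :
  (0 < d)%N -> finite_set (@cyl n d r h).
Proof. by move=> /(finite_L0 n); apply: sub_finite_set => f []. Qed.

Lemma card_cyl0 d n (h : {ffun vert 0 d -> int}) :
  #|` fset_set (@cyl n d 0 h)| = root_count d n `|root_val h|.
Proof.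
rewrite -(card_L0_at _ _ _).2; congr (#|` fset_set _|).
by apply/seteqP; split => f /cyl0P.
Qed.

Definition root_lip d r (h : {ffun vert r.+1 d -> int}) : bool :=
  [forall i, `|root_val h - root_val (branch i h)| <= 1].

(** For a fixed root value the branches are independent. If [h] jumps by more than 1 at a root edge,
    the cylinder is empty, hence the factor [root_lip h]. *)
Lemma card_cyl_branch d n r (h : {ffun vert r.+1 d -> int}) : (0 < d)%N ->
  #|` fset_set (@cyl n.+1 d r.+1 h)| =
  (root_lip h * \prod_(i < d) #|` fset_set (@cyl n d r (branch i h))|)%N.
Proof.
move=> d0; have [/forallP hl|/forallP hl] := boolP (root_lip h).
  rewrite mul1n -(finite_card_branch (root_val h) _).2; congr (#|` fset_set _|).
  apply/seteqP; split => f /=.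
    move=> /cyl_branchP[f0 fi _]; split=> // i.
    by rewrite in_fset_set ?mem_set //; exact: finite_cyl.
  move=> [f0 fi]; apply/cyl_branchP; split=> // i.
  by have := fi i; rewrite in_fset_set => [/set_mem //|]; exact: finite_cyl.
rewrite mul0n; apply/eqP; rewrite cardfs_eq0; apply/eqP.
rewrite -[RHS]fset_set0; congr fset_set; apply/seteqP; split => f //.
by move=> /cyl_branchP[_ _ hi]; case: hl.
Qed.

Definition res_ball d n r (f : {ffun vert n d -> int}) : {ffun vert r d -> int} :=
  [ffun w => f (mkvert n (vseq w))].

Lemma fset_cyl d n r (h : {ffun vert r d -> int}) : (0 < d)%N -> (r <= n)%N ->
  fset_set (@cyl n d r h) = [fset f in fset_set (@L0 n d) | res_ball r f == h].
Proof.
move=> d0 rn; have wn (w : vert r d) : (size (vseq w) <= n)%N.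
  exact: leq_trans (size_vseq w) rn.
apply/fsetP => f; rewrite in_fset_set ?inE; last exact: finite_cyl.
rewrite in_fset_set; last exact: finite_L0.
apply/idP/andP => [/set_mem[Lf fh]|[/set_mem Lf /eqP fh]].
  by rewrite mem_set //; split=> //; apply/eqP/ffunP => w; rewrite ffunE; apply: fh; rewrite vseq_mkvert.
by apply/mem_set; split=> // v w vw; rewrite -fh ffunE -vw vseqK.
Qed.

Lemma fset_L0_at d n (k : int) : (0 < d)%N ->
  fset_set (L0_at d n k) = [fset f in fset_set (@L0 n d) | root_val f == k].
Proof.
move=> d0; apply/fsetP => f; rewrite in_fset_set; last by case: (card_L0_at d n k).
rewrite !inE in_fset_set; last exact: finite_L0.
by apply/idP/andP => [/set_mem[Lf /eqP fk]|[/set_mem Lf /eqP fk]]; [split=> //|]; apply/mem_set.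
Qed.

Lemma card_L0_ball d n K : (0 < d)%N ->
  #|` [fset f in fset_set (@L0 n d) | root_val f \in int_ball K]| = ball_count d n K.
Proof.
move=> d0; rewrite -card_fset_fibers -sum_int_ball; apply: eq_bigr => k _.
by rewrite -fset_L0_at // (card_L0_at _ _ _).2.
Qed.

Lemma card_L0 d n : (0 < d)%N -> #|` fset_set (@L0 n d)| = ball_count d n n.
Proof.
move=> d0; rewrite -card_L0_ball //; congr (#|` _|); apply/fsetP => f.
rewrite !inE; case fL: (f \in _) => //=; rewrite in_int_ball.
move: fL; rewrite in_fset_set; last exact: finite_L0.
by move=> /set_mem /(L0_root_bound d0); lia.
Qed.

(** For r <= n cylinders are fibres of [res_ball r], hence disjoint; for r > n, configurations
    differing only below depth n would share a cylinder. *)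
Lemma sum_card_cyl_le d n r (H : {fset {ffun vert r d -> int}}) :
  (0 < d)%N -> (r <= n)%N ->
  (\sum_(h <- H) #|` fset_set (@cyl n d r h)| <= #|` fset_set (@L0 n d)|)%N.
Proof.
move=> d0 rn; under eq_bigr do rewrite fset_cyl //.
rewrite card_fset_fibers; apply: fsubset_leq_card.
by apply/fsubsetP => f; rewrite !inE => /andP[].
Qed.

(** The shift by [M] turns values in [-M, M] into ordinals, so the set is finite by construction. *)
Definition bounded_configs d r M : {fset {ffun vert r d -> int}} :=
  [fset [ffun v => (val (g v))%:Z - M%:Z]
     | g : {ffun vert r d -> 'I_(M + M).+1} in predT].

Lemma in_bounded_configs d r M (h : {ffun vert r d -> int}) :
  (forall v, `|h v| <= M%:Z) -> h \in bounded_configs d r M.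
Proof.
move=> hM; apply/imfsetP.
exists [ffun v => inord (absz (h v + M%:Z)%R)] => //.
by apply/ffunP => v; rewrite !ffunE /= inordK; have := hM v; move: (h v : int) => x; lia.
Qed.

(** A root value in [-K, K] forces values in [-(K + r), K + r] on the ball. The finite set of
    configurations is the same for all n: this is tightness. *)
Lemma sum_card_cyl_ge d n r K : (0 < d)%N -> (r <= n)%N ->
  (ball_count d n K <=
   \sum_(h <- bounded_configs d r (K + r)) #|` fset_set (@cyl n d r h)|)%N.
Proof.
move=> d0 rn; under eq_bigr do rewrite fset_cyl //.
rewrite card_fset_fibers -card_L0_ball //; apply: fsubset_leq_card.
apply/fsubsetP => f; rewrite !inE => /andP[fL]; rewrite fL in_int_ball /= => fK.
move: fL; rewrite in_fset_set; last exact: finite_L0.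
move=> /set_mem Lf; apply: in_bounded_configs => w; rewrite ffunE.
have wr := size_vseq w.
by have := L0_bound Lf (leq_trans wr rn); lia.
Qed.

Local Close Scope fset_scope.

(** * Limits of cylinder probabilities *)

(** Factoring a_n(0) out of the recursion leaves d-th powers of the ratios, so real d-th roots are
    never extracted. *)
Lemma root_count_ratio (R : realFieldType) d n k : (0 < d)%N ->
  (root_count d n k)%:R = (root_count d n 0)%:R * root_ratio R d n k ^+ d.
Proof.
move=> d0; elim: n k => [|n IH] [|k] /=.
- by rewrite expr1n mulr1.
- by rewrite expr0n gtn_eqF // mulr0.
- by rewrite expr1n mulr1.
have N0 : 1 + 2 * root_ratio R d n 1 ^+ d != 0.
  by rewrite gt_eqF // ltr_wpDr ?mulr_ge0 ?exprn_ge0 ?root_ratio_ge0.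
rewrite !natrX -exprMn (natrD _ (root_count d n 0)) natrM.
rewrite (natrD _ _ (root_count d n k.+2)) natrD; congr (_ ^+ _).
rewrite (IH k) (IH k.+1) (IH k.+2) (IH 1%N).
by field.
Qed.

Lemma ball_count_ratio (R : realFieldType) d n K : (0 < d)%N ->
  (ball_count d n K)%:R =
  (root_count d n 0)%:R * (1 + 2 * \sum_(k < K) root_ratio R d n k.+1 ^+ d).
Proof.
move=> d0; rewrite natrD natrM natr_sum mulrDr mulr1 mulrCA; congr (_ + _ * _).
by rewrite mulr_sumr; apply: eq_bigr => k _; exact: root_count_ratio.
Qed.

Lemma cvg_sum_seq (R : realType) (I : Type) (s : seq I) (f : I -> nat -> R) (l : I -> R) :
  (forall i, f i @ \oo --> l i) ->
  (fun n => \sum_(i <- s) f i n) @ \oo --> \sum_(i <- s) l i.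
Proof.
move=> fl; elim: s => [|i s IH].
  by rewrite big_nil; under eq_cvg do rewrite big_nil; exact: cvg_cst.
by rewrite big_cons; under eq_cvg do rewrite big_cons; exact: cvgD (fl i) IH.
Qed.

Lemma cvg_prod_seq (R : realType) (I : Type) (s : seq I) (f : I -> nat -> R) (l : I -> R) :
  (forall i, f i @ \oo --> l i) ->
  (fun n => \prod_(i <- s) f i n) @ \oo --> \prod_(i <- s) l i.
Proof.
move=> fl; elim: s => [|i s IH].
  by rewrite big_nil; under eq_cvg do rewrite big_nil; exact: cvg_cst.
by rewrite big_cons; under eq_cvg do rewrite big_cons; exact: cvgM (fl i) IH.
Qed.

Lemma cvg_expr_seq (R : realType) (u : nat -> R) (l : R) m :
  u @ \oo --> l -> (fun n => u n ^+ m) @ \oo --> l ^+ m.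
Proof.
move=> ul; elim: m => [|m IH].
  by rewrite expr0; under eq_cvg do rewrite expr0; exact: cvg_cst.
by rewrite exprS; under eq_cvg do rewrite exprS; exact: cvgM ul IH.
Qed.

Lemma cvg_mul_seq (R : realType) (u v : nat -> R) (a b : R) :
  u @ \oo --> a -> v @ \oo --> b -> (fun n => u n * v n) @ \oo --> a * b.
Proof. exact: cvgM. Qed.

Lemma cvg_inv_seq (R : realType) (u : nat -> R) (a : R) :
  a != 0 -> u @ \oo --> a -> (fun n => (u n)^-1) @ \oo --> a^-1.
Proof. exact: cvgV. Qed.

Lemma cvg_affine_seq (R : realType) (u : nat -> R) (l a b : R) :
  u @ \oo --> l -> (fun n => a + b * u n) @ \oo --> a + b * l.
Proof.
move=> ul; apply: cvgD; first exact: cvg_cst.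
by apply: cvgM => //; exact: cvg_cst.
Qed.

Lemma root_count_neq0 (R : numDomainType) d n : (root_count d n 0)%:R != 0 :> R.
Proof. by rewrite pnatr_eq0 -lt0n root_count_gt0. Qed.

(** Dividing by a_n(0) rather than by the total keeps the recursion multiplicative: a_(n+1)(0) =
    (a_n(0) (1 + 2 X_1))^d supplies one factor a_n(0) per branch. *)
Lemma cyl_count_cvg (R : realType) d (zeta : nat -> R) r (h : {ffun vert r d -> int}) :
  (0 < d)%N -> (forall k, (fun n => root_ratio R d n k) @ \oo --> zeta k) ->
  exists2 g : R, 0 <= g &
    (fun n => #|` fset_set (@cyl n d r h)|%:R / (root_count d n 0)%:R) @ \oo --> g.
Proof.
move=> d0 rho; have zeta0 k : 0 <= zeta k.
  by apply: cvgr_to_ge (rho k) _; apply: nearW => n; exact: root_ratio_ge0.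
have N0 z : 0 <= z -> 1 + 2 * z ^+ d != 0 :> R.
  by move=> z0; rewrite gt_eqF // ltr_wpDr ?mulr_ge0 ?exprn_ge0.
elim: r h => [|r IH] h.
  exists (zeta `|root_val h|%N ^+ d); first by rewrite exprn_ge0.
  under eq_cvg => n do rewrite card_cyl0 (root_count_ratio _ _ _ d0) mulrAC divff ?root_count_neq0 // mul1r.
  exact: cvg_expr_seq.
have /choice[g gP] : forall i, exists g : R, 0 <= g /\
    (fun n => #|` fset_set (@cyl n d r (branch i h))|%:R / (root_count d n 0)%:R) @ \oo --> g.
  by move=> i; have [g g0 gl] := IH (branch i h); exists g.
exists ((root_lip h)%:R * \prod_(i < d) g i * (1 + 2 * zeta 1%N ^+ d)^-1 ^+ d).
  rewrite !mulr_ge0 ?exprn_ge0 ?invr_ge0 ?addr_ge0 ?mulr_ge0 ?exprn_ge0 //.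
  by apply: prodr_ge0 => i _; case: (gP i).
rewrite -cvg_shiftS /=.
have E n : #|` fset_set (@cyl n.+1 d r.+1 h)|%:R /
      ((root_count d n 0 + 2 * root_count d n 1) ^ d)%:R =
    (root_lip h)%:R *
    (\prod_(i <- index_enum 'I_d) (#|` fset_set (@cyl n d r (branch i h))|%:R / (root_count d n 0)%:R))
    * (1 + 2 * root_ratio R d n 1 ^+ d)^-1 ^+ d.
  rewrite card_cyl_branch // natrM natr_prod natrX natrD natrM (root_count_ratio _ _ 1 d0).
  rewrite big_split /= prodr_const card_ord -[X in X + _]mulr1 mulrCA -mulrDr exprMn invfM.
  by rewrite !exprVn -!mulrA.
under eq_cvg do rewrite E.
apply: cvgM; last first.
  apply: cvg_expr_seq; apply: cvgV; first exact: N0.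
  by apply: cvgD; [exact: cvg_cst | apply: cvgM; [exact: cvg_cst | exact: cvg_expr_seq]].
apply: cvgM; first exact: cvg_cst.
by apply: cvg_prod_seq => i; case: (gP i).
Qed.

(* Mass cannot escape: [u K n] bounds from below the mass of a finite set at time
   [n], and the limits [w K] tend to the total mass 1. *)
Lemma esum_limit_eq1 (R : realType) (T : choiceType) (m : nat -> T -> R)
    (q : T -> R) (u : nat -> nat -> R) (w : nat -> R) (r : nat) :
  (forall h, 0 <= q h) -> (forall h, m ^~ h @ \oo --> q h) ->
  (forall (H : {fset T}) n, (r <= n)%N -> \sum_(h <- H) m n h <= 1) ->
  (forall K, exists H : {fset T}, forall n, (r <= n)%N -> u K n <= \sum_(h <- H) m n h) ->
  (forall K, u K @ \oo --> w K) -> w @ \oo --> (1 : R) ->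
  (\esum_(h in [set: T]) (q h)%:E = 1)%E.
Proof.
move=> q0 mq mass tight uw w1.
have sumq (H : {fset T}) : (\sum_(h \in [set` H]) (q h)%:E)%E = (\sum_(h <- H) q h)%:E.
  by rewrite fsbig_finite ?set_fsetK ?sumEFin //; exact: finite_fset.
have cvgH (H : {fset T}) : (fun n => \sum_(h <- H) m n h) @ \oo --> \sum_(h <- H) q h.
  exact: cvg_sum_seq mq.
have le1 : (\esum_(h in [set: T]) (q h)%:E <= 1)%E.
  apply: ge_ereal_sup => _ [F [finF _] <-].
  rewrite -(fset_setK finF) sumq lee_fin.
  apply: cvgr_to_le (cvgH (fset_set F)) _.
  by exists r => // n /= rn; exact: mass.
have ge_w K : ((w K)%:E <= \esum_(h in [set: T]) (q h)%:E)%E.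
  have [H uH] := tight K.
  apply: esum_ge; exists [set` H]; first by split=> //; exact: finite_fset.
  rewrite sumq lee_fin; apply: ler_cvg_to (uw K) (cvgH H) _.
  by exists r => // n /= rn; exact: uH.
apply/eqP; rewrite eq_le le1 /=.
(* The upper bound excludes +oo, the lower bound -oo. *)
case: (esum _ _) le1 ge_w => [e _ ge_w|//|_ /(_ 0%N)//].
by rewrite lee_fin; apply: cvgr_to_le w1 _; apply: nearW => K; have := ge_w K; rewrite lee_fin.
Qed.

Lemma parity_gap_not_cvg (R : realType) (u : nat -> R) (b c l : R) : b < c ->
  (forall n, u n.*2 <= b /\ c <= u n.*2.+1) -> ~ (u @ \oo --> l).
Proof.
move=> bc osc ul; have e0 : 0 < (c - b) / 3 by lra.
have /cvgrPdist_le/(_ _ e0)[N _ HN] := ul.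
have [h1 h2] := osc N.
have NN : (N <= N.*2)%N by rewrite -addnn leq_addr.
have := HN _ (leqW NN); have := HN _ NN.
by rewrite /= !ler_norml => /andP[? ?] /andP[? ?]; lra.
Qed.

(** * Local weak convergence in terms of the ratios *)

Local Notation RR := Rdefinitions.R.

Lemma mu0_ball_sum_le1 d n r (H : {fset {ffun vert r d -> int}}) :
  (0 < d)%N -> (r <= n)%N -> \sum_(h <- H) @mu0_ball n d r h <= 1.
Proof.
move=> d0 rn; rewrite /mu0_ball -mulr_suml -natr_sum ler_pdivrMr ?mul1r.
  by rewrite ler_nat; exact: sum_card_cyl_le.
by rewrite ltr0n card_L0 // addn_gt0 root_count_gt0.
Qed.

Lemma mu0_ball_sum_ge d n r K : (0 < d)%N -> (r <= n)%N ->
  (ball_count d n K)%:R / (ball_count d n n)%:R <=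
  \sum_(h <- bounded_configs d r (K + r)) @mu0_ball n d r h :> RR.
Proof.
move=> d0 rn; rewrite /mu0_ball -mulr_suml -natr_sum card_L0 //.
by rewrite ler_wpM2r ?invr_ge0 // ler_nat; exact: sum_card_cyl_ge.
Qed.

(** The total count divided by a_n(0) tends to 1 + 2 S. The mass of root values in [-K, K] tends to
    [w K], and [w K] tends to 1 because both sums have the same limit [S]. *)
Lemma local_weak_conv_of_limit d (zeta : nat -> RR) (S : RR) : (0 < d)%N ->
  (forall k, (fun n => root_ratio RR d n k) @ \oo --> zeta k) ->
  (fun n => \sum_(k < n) root_ratio RR d n k.+1 ^+ d) @ \oo --> S ->
  (fun n => \sum_(k < n) zeta k.+1 ^+ d) @ \oo --> S ->
  local_weak_conv d.
Proof.
move=> d0 rho rhoS zetaS r.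
have S0 : 0 <= S.
  apply: cvgr_to_ge rhoS _; apply: nearW => n; apply: sumr_ge0 => k _.
  by rewrite exprn_ge0 // root_ratio_ge0.
pose Z : RR := 1 + 2 * S; have Z0 : 0 < Z by rewrite ltr_wpDr ?mulr_ge0.
have cvgZ (u : nat -> RR) (l : RR) : u @ \oo --> l -> (fun n => 1 + 2 * u n) @ \oo --> 1 + 2 * l.
  exact: cvg_affine_seq.
have /choice[g gP] : forall h : {ffun vert r d -> int}, exists g : RR, 0 <= g /\
    (fun n => #|` fset_set (@cyl n d r h)|%:R / (root_count d n 0)%:R) @ \oo --> g.
  by move=> h; have [g g0 gl] := cyl_count_cvg h d0 rho; exists g.
pose q h := g h / Z.
have A0 n := root_count_neq0 RR d n.
have qP h : (fun n => @mu0_ball n d r h) @ \oo --> q h.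
  have E n : @mu0_ball n d r h = #|` fset_set (@cyl n d r h)|%:R / (root_count d n 0)%:R
      * (1 + 2 * \sum_(k < n) root_ratio RR d n k.+1 ^+ d)^-1.
    by rewrite /mu0_ball card_L0 // ball_count_ratio // invfM mulrA.
  under eq_cvg do rewrite E.
  apply: cvg_mul_seq; first by case: (gP h).
  by apply: cvg_inv_seq; [rewrite gt_eqF | exact: cvgZ].
have q0 h : 0 <= q h by rewrite divr_ge0 ?(ltW Z0) //; case: (gP h).
exists q; split; [exact: q0 | split; [| exact: qP]].
pose w K := (1 + 2 * \sum_(k < K) zeta k.+1 ^+ d) / Z.
pose u K n : RR := (ball_count d n K)%:R / (ball_count d n n)%:R.
apply: (@esum_limit_eq1 _ _ (fun n h => @mu0_ball n d r h) q u w r) => //.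
- by move=> H n rn; exact: mu0_ball_sum_le1.
- by move=> K; exists (bounded_configs d r (K + r)) => n rn; exact: mu0_ball_sum_ge.
- move=> K.
  have E n : u K n = (1 + 2 * \sum_(k < K) root_ratio RR d n k.+1 ^+ d)
      * (1 + 2 * \sum_(k < n) root_ratio RR d n k.+1 ^+ d)^-1.
    by rewrite /u !ball_count_ratio // -mulf_div divff // mul1r.
  under eq_cvg do rewrite E.
  apply: cvg_mul_seq; last by apply: cvg_inv_seq; [rewrite gt_eqF | exact: cvgZ].
  by apply: cvgZ; apply: cvg_sum_seq => k; exact: cvg_expr_seq.
- rewrite -(divff (negbT (gt_eqF Z0))); apply: cvg_mul_seq; last exact: cvg_cst.
  exact: cvgZ.
Qed.

Lemma mu0_ball_root d n (k : int) : (0 < d)%N ->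
  @mu0_ball n d 0 [ffun=> k] = (root_count d n `|k|)%:R / (ball_count d n n)%:R.
Proof. by move=> d0; rewrite /mu0_ball card_cyl0 card_L0 // /root_val ffunE. Qed.

(** X_1 is the quotient of the probabilities of the root values 1 and 0, in which the total count
    cancels. *)
Lemma local_weak_conv_root_ratio d : (0 < d)%N -> local_weak_conv d ->
  exists l : RR, (fun n => root_ratio RR d n 1 ^+ d) @ \oo --> l.
Proof.
move=> d0 /(_ 0%N)[q [q0 [q1 qP]]].
have hE (h : {ffun vert 0 d -> int}) : h = [ffun=> root_val h].
  apply/ffunP => v; rewrite ffunE -[v]vseqK; congr (h (mkvert _ _)).
  by apply: size0nil; have := size_vseq v; case: size.
have qmax h : q h <= q [ffun=> 0].
  apply: ler_cvg_to (qP h) (qP [ffun=> 0]) _; apply: nearW => n.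
  rewrite (hE h) !mu0_ball_root // ler_wpM2r ?invr_ge0 // ler_nat.
  elim: `|root_val h|%N => [//|k]; apply: leq_trans.
  exact: root_count_nincr.
(* Since 0 is the most likely value, q = 0 there would force q = 0 everywhere, against total mass
   1. *)
have qpos : q [ffun=> 0] != 0.
  apply/eqP => q00; move: q1; rewrite esum1 => [/esym/eqP|h _]; first by rewrite onee_eq0.
  by congr EFin; apply/eqP; rewrite eq_le q0 -q00 qmax.
exists (q [ffun=> 1] / q [ffun=> 0]).
have E n : root_ratio RR d n 1 ^+ d =
    @mu0_ball n d 0 [ffun=> 1] * (@mu0_ball n d 0 [ffun=> 0])^-1.
  have A0 := root_count_neq0 RR d n.
  have B0 : (ball_count d n n)%:R != 0 :> RR.
    by rewrite pnatr_eq0 -lt0n addn_gt0 root_count_gt0.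
  rewrite !mu0_ball_root // (root_count_ratio _ n 1 d0) /=.
  by field; apply/andP.
under eq_cvg do rewrite E.
by apply: cvg_mul_seq; [exact: qP | apply: cvg_inv_seq; [exact: qpos | exact: qP]].
Qed.

Theorem theorem1p1 (d : nat) : (2 <= d)%N -> (local_weak_conv d <-> (d <= 7)%N).
Proof.
move=> d2; have d0 : (0 < d)%N by exact: leq_trans d2.
split=> [conv|d7]; last first.
  have [|zeta [S [rho rhoS zetaS]]] := @root_ratio_limit RR d; first by rewrite d2.
  exact: local_weak_conv_of_limit rho rhoS zetaS.
have [l rl] := local_weak_conv_root_ratio d0 conv.
rewrite leqNgt; apply/negP => d8.
have [b b25 osc] := root_ratio_oscillates RR d8.
exact: parity_gap_not_cvg b25 osc rl.
Qed.
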